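(* Let $1\leq k\leq n$ be integers. For $r=1,\dots,k$ let $A_r\mathbf{x}_r=b_r$ be the system of $r+1$ linear equations in the $r+1$ variables $\mathbf{x}_r=(x_{0,r},\dots,x_{r,r})$ with coefficients in $\mathbf{Z}$ given by $$\sum_{j=0}^r(-1)^j\binom{n-j}{l-j}x_{j,r}=0\quad (l=k,k-1,\dots,k-r+1),\qquad \sum_{j=0}^r(-1)^j\binom{n-j}{k-r-j}x_{j,r}=1 .$$ Let $F$ be a field and let $\mathcal{P}^k(\mathcal{O}(n))$ be the module of principal parts on $\mathbf{P}^1_F$, considered as a left $\mathcal{O}_{\mathbf{P}^1}$-module. (a) For each $r=1,\dots,k$, a solution $\mathbf{x}_r$ of $A_r\mathbf{x}_r=b_r$ with coefficients in $F$ gives rise to a map of left $\mathcal{O}_{\mathbf{P}^1}$-modules $\phi_r:\mathcal{O}(n-k)\to\mathcal{P}^k(\mathcal{O}(n))$, namely the one given on $U_0$ and $U_1$ by $$\phi_r(x_0^{n-k})=\sum_{l=0}^{k-r}c^r_l\,t^{k-r-l}\,dt^l\otimes x_0^n,\qquad \phi_r(x_1^{n-k})=\sum_{j=0}^r x_{j,r}\,t^{j-r}\,ds^j\otimes x_1^n,$$ where $c^r_l=\sum_{j=0}^r(-1)^j\binom{n-j}{l-j}x_{j,r}$. (b) Put $x_{0,0}=1$ and let $\phi_0:\mathcal{O}(n-k)\to\mathcal{P}^k(\mathcal{O}(n))$ be the map of left $\mathcal{O}_{\mathbf{P}^1}$-modules given by $\phi_0(x_0^{n-k})=\sum_{l=0}^k\binom{n}{l}t^{k-l}dt^l\otimes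 x_0^n$ on $U_0$ and $\phi_0(x_1^{n-k})=1\otimes x_1^n$ on $U_1$. Assume that for all $r=1,\dots,k$ the system $A_r\mathbf{x}_r=b_r$ has a solution $\mathbf{x}_r$ with coefficients in $F$ such that $\prod_{i=0}^k x_{i,i}\neq 0$. Then the map $\phi=\oplus_{i=0}^k\phi_i$ is an isomorphism $$\oplus_{i=0}^k\mathcal{O}(n-k)\;\cong\;\mathcal{P}^k(\mathcal{O}(n))$$ of left $\mathcal{O}_{\mathbf{P}^1}$-modules.
   Context: Let $X=\mathbf{P}^1_F=\operatorname{Proj}F[x_0,x_1]$, let $p,q:X\times_F X\to X$ be the first and second projections, let $\mathcal{I}$ be the ideal sheaf of the diagonal, and $\mathcal{O}_{\Delta^k}=\mathcal{O}_{X\times X}/\mathcal{I}^{k+1}$. Then $\mathcal{P}^k(\mathcal{O}(n))=p_*(\mathcal{O}_{\Delta^k}\otimes q^*\mathcal{O}(n))$, and its left $\mathcal{O}_X$-module structure is the one as a push-forward along $p$. Put $U_i=D(x_i)$ for $i=0,1$ and $U_{01}=U_0\cap U_1$. Let $t=x_1/x_0$ be the coordinate on the first factor and $u$ the same coordinate on the second factor, so that on $U_{01}$ one has $x_1^m=t^mx_0^m$ in $\mathcal{O}(m)$, $\mathcal{O}_{\Delta^k}$ corresponds to $F[t,\frac1t,u,\frac1u]/(u-t,\frac1u-\frac1t)^{k+1}$, and left multiplication is multiplication by functions of $t$. Write $dt^i=(u-t)^i$ and $ds^i=(\frac1u-\frac1t)^i$. As left module, $\mathcal{P}^k(\mathcal{O}(n))$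 is free on $U_0$ over $F[t]$ with basis $dt^i\otimes x_0^n$, $0\le i\le k$ (where $dt^0=1$), and free on $U_1$ over $F[\frac1t]$ with basis $ds^i\otimes x_1^n$, $0\le i\le k$ (where $ds^0=1$). The sheaf $\mathcal{O}(n-k)$ is free on $U_i$ with basis $x_i^{n-k}$. Convention: $\binom{a}{b}=0$ for $b<0$. *)

(* Defs.v *)
From HB Require Import structures.
From mathcomp Require Import all_boot all_order all_algebra.
From mathcomp Require Import boolp ring.

Set Implicit Arguments.
Unset Strict Implicit.
Unset Printing Implicit Defensive.

Import GRing.Theory.
Local Open Scope ring_scope.
Local Open Scope quotient_scope.

(* The e-th power of the ideal generated by the g_j: it is generated by the
   products of e of the g_j. *)
Section IdealPower.
Variables (A : comNzRingType) (J : finType) (g : J -> A) (e : nat).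

Definition ideal_pow : {pred A} := fun z =>
  `[< exists c : {ffun 'I_e -> J} -> A,
        z = \sum_(w : {ffun 'I_e -> J}) c w * \prod_(i < e) g (w i) >].

Lemma ideal_powP z : reflect
  (exists c : {ffun 'I_e -> J} -> A,
        z = \sum_(w : {ffun 'I_e -> J}) c w * \prod_(i < e) g (w i))
  (z \in ideal_pow).
Proof. by apply: (iffP (asboolP _)). Qed.

Lemma ideal_pow_zmod_closed : zmod_closed ideal_pow.
Proof.
split=> [|x y /ideal_powP[c ->] /ideal_powP[d ->]]; apply/ideal_powP.
  by exists (fun=> 0); rewrite big1 // => w _; rewrite mul0r.
exists (fun w => c w - d w); rewrite -sumrB.
by apply: eq_bigr => w _; rewrite mulrBl.
Qed.

HB.instance Definition _ :=
  GRing.isZmodClosed.Build A ideal_pow ideal_pow_zmod_closed.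

Lemma ideal_powMl a x : x \in ideal_pow -> a * x \in ideal_pow.
Proof.
move=> /ideal_powP[c ->]; apply/ideal_powP; exists (fun w => a * c w).
by rewrite mulr_sumr; apply: eq_bigr => w _; rewrite mulrA.
Qed.

Lemma ideal_pow_gen (w : {ffun 'I_e -> J}) :
  \prod_(i < e) g (w i) \in ideal_pow.
Proof.
apply/ideal_powP; exists (fun v => (v == w)%:R).
rewrite (bigD1 w) //= eqxx mul1r [X in _ + X]big1 ?addr0 // => v /negbTE->.
by rewrite mul0r.
Qed.

Variables (R : nzRingType) (h : {rmorphism R -> A}).

(* A / (g_j : j in J)^e, regarded as an R-module through h : R -> A. *)
Definition quot_mod of {rmorphism R -> A} : Type := {ideal_quot ideal_pow}.

HB.instance Definition _ :=
  GRing.Zmodule.copy (quot_mod h) {ideal_quot ideal_pow}.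

Definition quot_cl (a : A) : (quot_mod h) := \pi_({ideal_quot ideal_pow}) a.

Definition quot_scale (r : R) (x : (quot_mod h)) : (quot_mod h) :=
  quot_cl (h r * repr (x : {ideal_quot ideal_pow})).

Lemma quot_cl_eq a b : (quot_cl a = quot_cl b) <-> (a - b \in ideal_pow).
Proof.
rewrite Quotient.idealrBE; split=> [E|/eqP//].
exact/eqP.
Qed.

Lemma quot_cl_is_zmod_morphism : zmod_morphism quot_cl.
Proof. exact: (raddfB (\pi_({ideal_quot ideal_pow}))). Qed.

HB.instance Definition _ :=
  GRing.isZmodMorphism.Build A (quot_mod h) quot_cl quot_cl_is_zmod_morphism.

Lemma quot_cl_surj (x : (quot_mod h)) : {a | x = quot_cl a}.
Proof. by exists (repr (x : {ideal_quot ideal_pow})); rewrite /quot_cl reprK. Qed.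

Lemma quot_scaleE r a : quot_scale r (quot_cl a) = quot_cl (h r * a).
Proof.
apply/quot_cl_eq; rewrite -mulrBr; apply: ideal_powMl.
by apply/quot_cl_eq; rewrite /quot_cl reprK.
Qed.

Fact quot_scaleA a b x :
  quot_scale a (quot_scale b x) = quot_scale (a * b) x.
Proof. by have [y ->] := quot_cl_surj x; rewrite !quot_scaleE rmorphM mulrA. Qed.

Fact quot_scale1 : left_id 1 quot_scale.
Proof.
by move=> x; have [y ->] := quot_cl_surj x; rewrite quot_scaleE rmorph1 mul1r.
Qed.

Fact quot_scaleDr : right_distributive quot_scale +%R.
Proof.
move=> a x y; have [z ->] := quot_cl_surj x; have [t ->] := quot_cl_surj y.
by rewrite -raddfD !quot_scaleE mulrDr raddfD.
Qed.

Fact quot_scaleDl x : {morph quot_scale^~ x : a b / a + b}.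
Proof.
move=> a b; have [z ->] := quot_cl_surj x.
by rewrite !quot_scaleE rmorphD mulrDl raddfD.
Qed.

HB.instance Definition _ := GRing.Zmodule_isLmodule.Build R (quot_mod h)
  quot_scaleA quot_scale1 quot_scaleDr quot_scaleDl.

Lemma quot_clZ r a : r *: quot_cl a = quot_cl (h r * a).
Proof. exact: quot_scaleE. Qed.

End IdealPower.

(* F[t, 1/t] and F[t, 1/t, u, 1/u], as subrings of F(t, u).  In
   {poly {poly F}} the inner variable 'X%:P is t and the outer one 'X is u. *)
Section Laurent.
Variable F : fieldType.

Definition ratfun := {fraction {poly {poly F}}}.
HB.instance Definition _ := GRing.Field.on ratfun.

Definition t_rat : ratfun := FracField.tofrac ('X%:P : {poly {poly F}}).
Definition u_rat : ratfun := FracField.tofrac ('X : {poly {poly F}}).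

Definition is_laurent : {pred ratfun} := fun f =>
  `[< exists N (p : {poly F}), t_rat ^+ N * f = FracField.tofrac p%:P >].

Definition is_bilaurent : {pred ratfun} := fun f =>
  `[< exists N (p : {poly {poly F}}),
        (t_rat * u_rat) ^+ N * f = FracField.tofrac p >].

Lemma t_rat_neq0 : t_rat != 0.
Proof. by rewrite tofrac_eq0 polyC_eq0 polyX_eq0. Qed.

Lemma u_rat_neq0 : u_rat != 0.
Proof. by rewrite tofrac_eq0 polyX_eq0. Qed.

Fact laurent_subring_closed : subring_closed is_laurent.
Proof.
have tE N : t_rat ^+ N = FracField.tofrac (('X^N)%:P : {poly {poly F}}).
  by rewrite !rmorphXn.
split; first by apply/asboolP; exists 0, 1; rewrite expr0 mulr1 polyC1 tofrac1.
- move=> f g /asboolP[N [p Ep]] /asboolP[M [q Eq]]; apply/asboolP.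
  exists (N + M), ('X^M * p - 'X^N * q).
  rewrite !(rmorphB, rmorphM) /= -!tE -Ep -Eq exprD; ring.
- move=> f g /asboolP[N [p Ep]] /asboolP[M [q Eq]]; apply/asboolP.
  exists (N + M), (p * q); rewrite !rmorphM /= -Ep -Eq exprD; ring.
Qed.

Fact bilaurent_subring_closed : subring_closed is_bilaurent.
Proof.
have tE N : (t_rat * u_rat) ^+ N
    = FracField.tofrac (('X%:P * 'X) ^+ N : {poly {poly F}}).
  by rewrite rmorphXn rmorphM.
split; first by apply/asboolP; exists 0, 1; rewrite expr0 mulr1 tofrac1.
- move=> f g /asboolP[N [p Ep]] /asboolP[M [q Eq]]; apply/asboolP.
  exists (N + M), (('X%:P * 'X) ^+ M * p - ('X%:P * 'X) ^+ N * q).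
  rewrite !(rmorphB, rmorphM) /= -!tE -Ep -Eq exprD; ring.
- move=> f g /asboolP[N [p Ep]] /asboolP[M [q Eq]]; apply/asboolP.
  exists (N + M), (p * q); rewrite !rmorphM /= -Ep -Eq exprD; ring.
Qed.

HB.instance Definition _ :=
  GRing.isSubringClosed.Build ratfun is_laurent laurent_subring_closed.
HB.instance Definition _ :=
  GRing.isSubringClosed.Build ratfun is_bilaurent bilaurent_subring_closed.

Record laurent := Laurent { laurent_val :> ratfun; _ : is_laurent laurent_val }.
HB.instance Definition _ := [isSub for laurent_val].
HB.instance Definition _ := [Choice of laurent by <:].
HB.instance Definition _ := [SubChoice_isSubComNzRing of laurent by <:].
HB.instance Definition _ :=
  GRing.RMorphism.copy laurent_val (val : laurent -> ratfun).

Record bilaurent :=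
  Bilaurent { bilaurent_val :> ratfun; _ : is_bilaurent bilaurent_val }.
HB.instance Definition _ := [isSub for bilaurent_val].
HB.instance Definition _ := [Choice of bilaurent by <:].
HB.instance Definition _ := [SubChoice_isSubComNzRing of bilaurent by <:].

Fact cst_subproof (c : F) : is_laurent (FracField.tofrac c%:P%:P).
Proof. by apply/asboolP; exists 0, c%:P; rewrite mul1r. Qed.
Definition cst (c : F) : laurent := Laurent (cst_subproof c).

Fact cst_is_zmod_morphism : zmod_morphism cst.
Proof. by move=> x y; apply: val_inj; rewrite /= !rmorphB. Qed.
HB.instance Definition _ :=
  GRing.isZmodMorphism.Build F laurent cst cst_is_zmod_morphism.

Fact cst_is_monoid_morphism : monoid_morphism cst.
Proof.
by split=> [|x y]; apply: val_inj; rewrite /= ?rmorph1 // !rmorphM.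
Qed.
HB.instance Definition _ :=
  GRing.isMonoidMorphism.Build F laurent cst cst_is_monoid_morphism.

Fact incl_subproof (f : laurent) : is_bilaurent (val f).
Proof.
case: f => f /= /asboolP[N [p Ep]]; apply/asboolP.
exists N, ('X ^+ N * p%:P); rewrite exprMn rmorphM rmorphXn /= -Ep; ring.
Qed.
Definition incl (f : laurent) : bilaurent := Bilaurent (incl_subproof f).

Fact incl_is_zmod_morphism : zmod_morphism incl.
Proof. by move=> x y; apply: val_inj. Qed.
HB.instance Definition _ :=
  GRing.isZmodMorphism.Build laurent bilaurent incl incl_is_zmod_morphism.

Fact incl_is_monoid_morphism : monoid_morphism incl.
Proof. by split=> [|x y]; apply: val_inj. Qed.
HB.instance Definition _ :=
  GRing.isMonoidMorphism.Build laurent bilaurent incl incl_is_monoid_morphism.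

Fact t_subproof : is_laurent t_rat.
Proof. by apply/asboolP; exists 0, 'X; rewrite mul1r. Qed.
Fact tV_subproof : is_laurent t_rat^-1.
Proof. by apply/asboolP; exists 1, 1; rewrite divff ?t_rat_neq0 // !rmorph1. Qed.
Fact u_subproof : is_bilaurent u_rat.
Proof. by apply/asboolP; exists 0, 'X; rewrite mul1r. Qed.
Fact uV_subproof : is_bilaurent u_rat^-1.
Proof.
apply/asboolP; exists 1, 'X%:P.
by rewrite expr1 mulfK ?u_rat_neq0.
Qed.

(* The chart U_0 is indexed by false and U_1 by true; left_coord i is x_{1-i}/x_i
   on the first factor, right_coord i the same coordinate on the second one. *)
Definition left_coord (i : bool) : laurent :=
  if i then Laurent tV_subproof else Laurent t_subproof.
Definition right_coord (i : bool) : bilaurent :=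
  if i then Bilaurent uV_subproof else Bilaurent u_subproof.

(* restriction of functions O(U_i) -> O(U_01), where both O(U_0) = F[t] and
   O(U_1) = F[1/t] are represented by {poly F} *)
Definition chart (i : bool) : {rmorphism {poly F} -> laurent} :=
  locked (horner_morph (fun c => mulrC (left_coord i) (cst c))
          : {rmorphism {poly F} -> laurent}).

(* The same on X x X, from O(U_i x U_i) to O(U_01 x U_01); in {poly {poly F}}
   the inner variable is the coordinate on the first factor. *)
Definition bichart (i : bool) : {rmorphism {poly {poly F}} -> bilaurent} :=
  locked (horner_morph (fun c => mulrC (right_coord i) ((incl \o chart i) c))
          : {rmorphism {poly {poly F}} -> bilaurent}).

Lemma left_coordK i : left_coord i * left_coord (~~ i) = 1.
Proof.
by case: i; apply: val_inj; rewrite /= ?mulVf ?mulfV ?t_rat_neq0.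
Qed.

Lemma right_coordK i : right_coord i * right_coord (~~ i) = 1.
Proof.
by case: i; apply: val_inj; rewrite /= ?mulVf ?mulfV ?u_rat_neq0.
Qed.

Lemma chartX i : chart i 'X = left_coord i.
Proof. by rewrite /chart -lock /= horner_morphX. Qed.

Lemma chartC i c : chart i c%:P = cst c.
Proof. by rewrite /chart -lock /= horner_morphC. Qed.

Lemma bichartX i : bichart i 'X = right_coord i.
Proof. by rewrite /bichart -lock /= horner_morphX. Qed.

Lemma bichartC i p : bichart i p%:P = incl (chart i p).
Proof. by rewrite /bichart -lock /= horner_morphC. Qed.

Lemma val_chart0 p : val (chart false p) = FracField.tofrac p%:P.
Proof.
elim/poly_ind: p => [|p c IH]; first by rewrite !rmorph0.
rewrite rmorphD rmorphM /= chartX [LHS]/= IH.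
by rewrite chartC /= polyCD polyCM rmorphD rmorphM.
Qed.

Lemma val_bichart0 p : val (bichart false p) = FracField.tofrac p.
Proof.
elim/poly_ind: p => [|p c IH]; first by rewrite !rmorph0.
rewrite rmorphD rmorphM /= bichartX bichartC [LHS]/= IH val_chart0.
by rewrite rmorphD rmorphM.
Qed.

Lemma bichart0_inj : injective (bichart false).
Proof.
by move=> p q /(congr1 val); rewrite !val_bichart0 => /eqP; rewrite tofrac_eq => /eqP.
Qed.

Lemma chart_inv i p :
  exists M q, left_coord (~~ i) ^+ M * chart i p = chart (~~ i) q.
Proof.
elim/poly_ind: p => [|p c [M [q E]]].
  by exists 0, 0; rewrite !rmorph0 mulr0.
exists M.+1, (q + 'X ^+ M.+1 * c%:P).
rewrite !(rmorphD, rmorphM, rmorphXn) /= !chartX -E !chartC exprS.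
have := left_coordK i; set a := left_coord _; set b := left_coord _ => ab.
rewrite -[b ^+ M * chart i p]mul1r -ab; ring.
Qed.

Lemma chart_denom i (f : laurent) :
  exists N p, left_coord i ^+ N * f = chart i p.
Proof.
have [N [p Ep]] : exists N p, left_coord false ^+ N * f = chart false p.
  case: f => f fP; have /asboolP[N [p Ep]] := fP; exists N, p; apply: val_inj.
  by rewrite val_chart0 -Ep rmorphM rmorphXn.
case: i; last by exists N, p.
have [M [q Eq]] := chart_inv false p; exists M, (q * 'X ^+ N).
rewrite rmorphM rmorphXn /= -Eq chartX -Ep /=.
transitivity (left_coord true ^+ M * (left_coord true * left_coord false) ^+ N * f).
  by rewrite (left_coordK true) expr1n mulr1.
by rewrite exprMn; ring.
Qed.

Lemma bichart_inv i p : exists M q,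
  (incl (left_coord (~~ i)) * right_coord (~~ i)) ^+ M * bichart i p
  = bichart (~~ i) q.
Proof.
elim/poly_ind: p => [|p c [M [q E]]].
  by exists 0, 0; rewrite !rmorph0 mulr0.
have [L [r Er]] := chart_inv i c.
exists (M + L).+1, ('X%:P ^+ L.+1 * 'X ^+ L * q
                    + 'X%:P ^+ M.+1 * 'X ^+ (M + L).+1 * r%:P).
rewrite !(rmorphD, rmorphM, rmorphXn) /= !bichartX !bichartC chartX -E -Er.
rewrite [incl (_ * _)]rmorphM rmorphXn /=.
have := right_coordK i; set a := right_coord _; set b := right_coord _ => ab.
set z := incl _; rewrite !exprMn !exprS !exprD.
transitivity (z ^+ M * z ^+ L * z * (b ^+ M * b ^+ L) * bichart i p * (a * b)
  + z * (z ^+ M * z ^+ L) * (b * (b ^+ M * b ^+ L)) * incl (chart i c)).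
  by ring.
by rewrite ab; ring.
Qed.

Lemma bichart_denom i (f : bilaurent) : exists N p,
  (incl (left_coord i) * right_coord i) ^+ N * f = bichart i p.
Proof.
have [N [p Ep]] : exists N p,
    (incl (left_coord false) * right_coord false) ^+ N * f = bichart false p.
  case: f => f fP; have /asboolP[N [p Ep]] := fP; exists N, p; apply: val_inj.
  by rewrite val_bichart0 -Ep rmorphM rmorphXn.
case: i; last by exists N, p.
have [M [q Eq]] := bichart_inv false p; exists M, (q * ('X%:P * 'X) ^+ N).
rewrite rmorphM rmorphXn rmorphM /= -Eq bichartX bichartC chartX -Ep /=.
have := right_coordK true; have := congr1 incl (left_coordK true).
rewrite rmorphM rmorph1 /=; set z := incl _; set z' := incl _.
set w := Bilaurent uV_subproof; set w' := Bilaurent u_subproof => zz ww.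
transitivity ((z * w) ^+ M * ((z * z') * (w * w')) ^+ N * f).
  by rewrite zz ww mulr1 expr1n mulr1.
by rewrite !exprMn; ring.
Qed.

(* substituting the inverse of a transcendental element *)
Lemma horner_inv_inj (B : nzRingType) (K : fieldType) (f : {rmorphism B -> K})
    (w : K) : w != 0 ->
  (forall p : {poly B}, (map_poly f p).[w] = 0 -> p = 0) ->
  forall p : {poly B}, (map_poly f p).[w^-1] = 0 -> p = 0.
Proof.
move=> w0 H p p0; pose n := size p.
suff /H E : (map_poly f (\poly_(i < n.+1) p`_(n - i))).[w] = 0.
  apply/polyP => i; rewrite coef0; have [ni|ni] := leqP n i.
    by rewrite nth_default.
  have := congr1 (fun q : {poly B} => q`_(n - i)) E.
  by rewrite coef_poly coef0 ltnS leq_subr subKn // ltnW.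
rewrite -(mulr0 (w ^+ n)) -p0.
rewrite (@horner_coef_wide _ n.+1); last first.
  exact: leq_trans (size_poly _ _) (size_poly _ _).
rewrite (@horner_coef_wide _ n.+1 (map_poly f p)); last first.
  exact: leq_trans (size_poly _ _) (leqnSn _).
rewrite mulr_sumr (reindex_inj rev_ord_inj) /=; apply: eq_bigr => i _.
have ni : (i <= n)%N by rewrite -ltnS.
rewrite !coef_map /= coef_poly !subSS ltnS leq_subr subKn // mulrCA.
congr (_ * _); rewrite exprVn; have := exprD w (n - i) i; rewrite subnK // => ->.
by rewrite mulfK ?expf_neq0.
Qed.

Lemma val_chart i q :
  val (chart i q)
  = (map_poly (laurent_val \o cst) q).[val (left_coord i)].
Proof.
elim/poly_ind: q => [|q c IH]; first by rewrite !rmorph0 horner0.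
rewrite !(rmorphD, rmorphM) /= map_polyX map_polyC hornerMXaddC -IH.
by rewrite chartX chartC.
Qed.

Lemma chart_inj i : injective (chart i).
Proof.
move=> p q /eqP; rewrite -subr_eq0 -rmorphB => /eqP E.
apply/eqP; rewrite -subr_eq0; apply/eqP; move: {p q}(p - q) E => p.
have inj0 q : chart false q = 0 -> q = 0.
  move=> /(congr1 val); rewrite val_chart0 => /eqP.
  by rewrite tofrac_eq0 polyC_eq0 => /eqP.
case: i; last exact: inj0.
move=> /(congr1 val); rewrite val_chart => E0.
apply: (horner_inv_inj t_rat_neq0 _ E0) => q.
rewrite -(val_chart false) => E; apply: inj0; exact: val_inj.
Qed.

Lemma val_bichart i q : val (bichart i q)
  = (map_poly (laurent_val \o chart i) q).[val (right_coord i)].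
Proof.
elim/poly_ind: q => [|q c IH]; first by rewrite !rmorph0 horner0.
rewrite !(rmorphD, rmorphM) /= map_polyX map_polyC hornerMXaddC -IH.
by rewrite bichartX bichartC.
Qed.

Arguments left_coord : simpl never.
Arguments right_coord : simpl never.

Lemma bichart_inj i : injective (bichart i).
Proof.
case: i; last exact: bichart0_inj.
move=> p q /eqP; rewrite -subr_eq0 -rmorphB => /eqP E.
apply/eqP; rewrite -subr_eq0; apply/eqP; move: {p q}(p - q) E => p.
move=> /(congr1 val); rewrite val_bichart => E0.
apply: (horner_inv_inj u_rat_neq0 _ E0) => {p E0} q E.
have [M [r Er]] : exists M r, map_poly (chart false) r
    = left_coord false ^+ M *: map_poly (chart true) q.
  elim/poly_ind: q {E} => [|q c [M [r IH]]].
    by exists 0, 0; rewrite !rmorph0 scaler0.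
  have [L [d Ed]] := chart_inv true c.
  exists (M + L), ('X^L *: r * 'X + ('X^M * d)%:P).
  rewrite !rmorphD !rmorphM /= !map_polyX !map_polyC map_polyZ IH.
  rewrite /= !rmorphXn /= !chartX -Ed scalerDr exprD.
  by rewrite -!mul_polyC !(polyCM, rmorphXn) /=; ring.
suff r0 : r = 0.
  apply/polyP => i; rewrite coef0; apply: (@chart_inj true).
  have /(congr1 (fun s : {poly laurent} => left_coord true ^+ M * s`_i)) := Er.
  rewrite r0 rmorph0 coef0 mulr0 coefZ coef_map mulrA -exprMn.
  by rewrite left_coordK expr1n mul1r rmorph0 => <-.
apply: bichart0_inj; rewrite rmorph0; apply: val_inj; rewrite val_bichart.
rewrite (map_poly_comp laurent_val) Er map_polyZ hornerZ -map_poly_comp.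
by rewrite [X in _ * X]E mulr0.
Qed.

End Laurent.

Arguments chart {F} i.
Arguments bichart {F} i.

Section Modules.
Variable F : fieldType.
Local Notation laurent := (laurent F).

(* A quasi-coherent O_X-module on X = P^1_F, given by its sections over U_0,
   U_1 and U_01 = D(x_{1-i}/x_i) in U_i, with the restriction maps; the last two
   fields say that each restriction is the localization at x_{1-i}/x_i. *)
Record qcoh := Qcoh {
  sec : bool -> lmodType {poly F};
  sec01 : lmodType laurent;
  res : forall i, {linear sec i -> sec01 | chart i \; *:%R};
  res_eq0 : forall i x, res i x = 0 -> exists N, 'X^N *: x = 0;
  res_frac : forall i y, exists N x, left_coord F i ^+ N *: y = res i x
}.

Record qmor (M N : qcoh) := Qmor {
  mor : forall i, {linear sec M i -> sec N i};
  mor01 : {linear sec01 M -> sec01 N};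
  mor_res : forall i x, mor01 (res M i x) = res N i (mor i x)
}.

Definition qmor_eq M N (f g : qmor M N) : Prop :=
  (forall i, mor f i =1 mor g i) /\ mor01 f =1 mor01 g.

Definition qmor_id M : qmor M M.
Proof. by exists (fun i => idfun) idfun. Defined.

Definition qmor_comp M N P (g : qmor N P) (f : qmor M N) : qmor M P.
Proof.
exists (fun i => mor g i \o mor f i) (mor01 g \o mor01 f) => i x /=.
by rewrite !mor_res.
Defined.

Definition is_qiso M N (f : qmor M N) : Prop := exists g : qmor N M,
  qmor_eq (qmor_comp g f) (qmor_id M) /\ qmor_eq (qmor_comp f g) (qmor_id N).

(* the direct sum of m copies of M *)
Section Power.
Variables (M : qcoh) (m : nat).

Definition qpow_res i (x : {ffun 'I_m -> sec M i}) : {ffun 'I_m -> sec01 M} :=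
  [ffun j => res M i (x j)].

Fact qpow_res_is_linear i : linear_for (chart i \; *:%R) (@qpow_res i).
Proof. by move=> a x y; apply/ffunP=> j; rewrite !ffunE linearP. Qed.

HB.instance Definition _ i := GRing.isLinear.Build {poly F} _ _ _
  (@qpow_res i) (@qpow_res_is_linear i).

Fact qpow_res_eq0 i x : @qpow_res i x = 0 -> exists N, 'X^N *: x = 0.
Proof.
move=> /ffunP x0.
have /choice[N NP] j : exists N, 'X^N *: x j = 0.
  by apply: (@res_eq0 M i); have := x0 j; rewrite !ffunE.
exists (\sum_j N j)%N; apply/ffunP => j; rewrite !ffunE (bigD1 j) //= addnC.
by rewrite exprD -scalerA NP scaler0.
Qed.

Fact qpow_res_frac i y :
  exists N x, left_coord F i ^+ N *: y = @qpow_res i x.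
Proof.
have /choice[N /choice[x xP]] j := @res_frac M i (y j).
exists (\sum_j N j)%N.
exists [ffun j => 'X^(\sum_(l | l != j) N l) *: x j].
apply/ffunP => j; rewrite !ffunE linearZ_LR /= -xP rmorphXn /= chartX.
by rewrite scalerA -exprD (bigD1 j) //= addnC.
Qed.

Definition qpow : qcoh :=
  @Qcoh (fun i => {ffun 'I_m -> sec M i}) {ffun 'I_m -> sec01 M}
    (fun i => @qpow_res i) qpow_res_eq0 qpow_res_frac.

End Power.

(* phi_0 (+) ... (+) phi_{m-1} : M (+) ... (+) M -> N *)
Section Sum.
Variables (M N : qcoh) (m : nat) (phi : 'I_m -> qmor M N).

Definition qsum_mor i (x : sec (qpow M m) i) : sec N i :=
  \sum_j mor (phi j) i ((x : {ffun _}) j).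
Definition qsum_mor01 (x : sec01 (qpow M m)) : sec01 N :=
  \sum_j mor01 (phi j) ((x : {ffun _}) j).

Fact qsum_mor_is_linear i : linear (@qsum_mor i).
Proof.
move=> a x y; rewrite /qsum_mor scaler_sumr -big_split /=.
by apply: eq_bigr => j _; rewrite !ffunE linearP.
Qed.
Fact qsum_mor01_is_linear : linear qsum_mor01.
Proof.
move=> a x y; rewrite /qsum_mor01 scaler_sumr -big_split /=.
by apply: eq_bigr => j _; rewrite !ffunE linearP.
Qed.

HB.instance Definition _ i := GRing.isLinear.Build {poly F} _ _ _
  (@qsum_mor i) (@qsum_mor_is_linear i).
HB.instance Definition _ := GRing.isLinear.Build laurent _ _ _
  qsum_mor01 qsum_mor01_is_linear.

Fact qsum_mor_res i x :
  qsum_mor01 (res (qpow M m) i x) = res N i (qsum_mor x).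
Proof.
rewrite /qsum_mor /qsum_mor01 raddf_sum; apply: eq_bigr => j _.
by rewrite ffunE mor_res.
Qed.

Definition qsum : qmor (qpow M m) N :=
  @Qmor (qpow M m) N (fun i => @qsum_mor i) qsum_mor01 qsum_mor_res.

End Sum.

(* O(m): its basis over U_i is x_i^m; over U_01 it is x_0^m, and
   x_1^m = t^m x_0^m. *)
Section LineBundle.
Variable m : nat.

Definition lb_glue (i : bool) : laurent :=
  if i then left_coord F false ^+ m else 1.

Lemma lb_glueK i : exists c, lb_glue i * c = 1.
Proof.
case: i; last by exists 1; rewrite mulr1.
by exists (left_coord F true ^+ m); rewrite -exprMn (left_coordK F false) expr1n.
Qed.

Definition lb_res i (f : {poly F}^o) : laurent^o := chart i f * lb_glue i.

Fact lb_res_is_linear i : linear_for (chart i \; *:%R) (lb_res i).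
Proof.
move=> a x y; rewrite /lb_res rmorphD mulrDl; congr (_ + _).
by rewrite [a *: x]/(a * x) rmorphM -mulrA.
Qed.

HB.instance Definition _ i := GRing.isLinear.Build {poly F} _ _ _
  (lb_res i) (@lb_res_is_linear i).

Fact lb_res_eq0 i x : lb_res i x = 0 -> exists N, 'X^N *: x = 0.
Proof.
move=> E; exists 0; rewrite scale1r; apply: (@chart_inj F i).
have [c cP] := lb_glueK i; have := congr1 ( *%R^~ c) E.
by rewrite /lb_res mul0r -mulrA cP mulr1 rmorph0.
Qed.

Fact lb_res_frac i (y : laurent^o) :
  exists N x, left_coord F i ^+ N *: y = lb_res i x.
Proof.
have [c cP] := lb_glueK i; have [N [p E]] := chart_denom i (y * c).
by exists N, p; rewrite /lb_res -E -!mulrA [c * _]mulrC cP mulr1.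
Qed.

Definition lb : qcoh := @Qcoh (fun i => {poly F}^o) laurent^o
  (fun i => lb_res i) lb_res_eq0 lb_res_frac.

End LineBundle.

(* P^k(O(n)) = p_*(O_{Delta^k} (x) q^*O(n)).  O_{Delta^k} is supported on the
   diagonal, so that its sections over p^{-1}(U) are those over U x U, for U any
   of U_0, U_1, U_01.  Over U_i x U_i the sheaf q^*O(n) has the basis x_i^n, over
   U_01 x U_01 it has the basis x_0^n, and there x_1^n = u^n x_0^n. *)
Section PrincipalParts.
Variables (k n : nat).

Definition diag_gen (_ : unit) : {poly {poly F}} := 'X - 'X%:P.

Definition diag_gen01 (i : bool) : bilaurent F :=
  right_coord F i - incl (left_coord F i).

(* functions of the first coordinate act on the left *)
Definition pp_sec : Type :=
  quot_mod diag_gen k.+1 (polyC : {rmorphism {poly F} -> {poly {poly F}}}).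
HB.instance Definition _ := GRing.Lmodule.on pp_sec.
Definition pp_sec01 : Type :=
  quot_mod diag_gen01 k.+1 (@incl F : {rmorphism laurent -> bilaurent F}).
HB.instance Definition _ := GRing.Lmodule.on pp_sec01.

Definition pp_cl : {poly {poly F}} -> pp_sec := quot_cl _ _ _.
HB.instance Definition _ := GRing.Additive.on pp_cl.
Definition pp_cl01 : bilaurent F -> pp_sec01 := quot_cl _ _ _.
HB.instance Definition _ := GRing.Additive.on pp_cl01.

Lemma pp_cl_eq f g : pp_cl f = pp_cl g <-> f - g \in ideal_pow diag_gen k.+1.
Proof. exact: quot_cl_eq. Qed.

Lemma pp_cl01_eq f g :
  pp_cl01 f = pp_cl01 g <-> f - g \in ideal_pow diag_gen01 k.+1.
Proof. exact: quot_cl_eq. Qed.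

Lemma pp_cl_surj x : exists f, x = pp_cl f.
Proof.
exists (repr (x : {ideal_quot _})); exact/esym/(@reprK _ {ideal_quot _}).
Qed.

Lemma pp_cl01_surj x : exists f, x = pp_cl01 f.
Proof.
exists (repr (x : {ideal_quot _})); exact/esym/(@reprK _ {ideal_quot _}).
Qed.

Lemma pp_clZ a f : a *: pp_cl f = pp_cl (a%:P * f).
Proof. exact: quot_clZ. Qed.

Lemma pp_cl01Z a f : a *: pp_cl01 f = pp_cl01 (incl a * f).
Proof. exact: quot_clZ. Qed.

Lemma ideal_pow_exp (A : comNzRingType) (J : finType) (g : J -> A) e j c :
  c * g j ^+ e \in ideal_pow g e.
Proof.
apply: ideal_powMl; have := ideal_pow_gen g [ffun _ : 'I_e => j].
by under eq_bigr do rewrite ffunE; rewrite prodr_const card_ord.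
Qed.

Lemma diag_gen_pow f e : f \in ideal_pow diag_gen e ->
  exists h, f = h * ('X - 'X%:P) ^+ e.
Proof.
move=> /ideal_powP[c ->]; exists (\sum_w c w); rewrite mulr_suml.
by apply: eq_bigr => w _; rewrite prodr_const card_ord.
Qed.

Lemma diag_gen01_dvd i j : exists c, diag_gen01 j = c * diag_gen01 i.
Proof.
have [->|/negPf ji] := eqVneq j i; first by exists 1; rewrite mul1r.
have -> : j = ~~ i by case: (i) (j) ji => -[].
exists (- (incl (left_coord F (~~ i)) * right_coord F (~~ i))).
have := right_coordK F i; have := congr1 (@incl F) (left_coordK F i).
rewrite rmorphM rmorph1 /= /diag_gen01.
set a := incl _; set b := incl _; set c := right_coord _ _.
set d := right_coord _ _ => ab cd.
transitivity (d * (a * b) - b * (c * d)); first by rewrite ab cd !mulr1.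
ring.
Qed.

Lemma diag_gen01_pow i f e : f \in ideal_pow diag_gen01 e ->
  exists h, f = h * diag_gen01 i ^+ e.
Proof.
have /choice[d dP] j := diag_gen01_dvd i j.
move=> /ideal_powP[c ->]; exists (\sum_w c w * \prod_(l < e) d (w l)).
rewrite mulr_suml; apply: eq_bigr => w _; rewrite -mulrA; congr (_ * _).
under eq_bigr do rewrite dP.
by rewrite big_split /= prodr_const card_ord.
Qed.

Lemma bichart_diag i : bichart i ('X - 'X%:P) = diag_gen01 i.
Proof. by rewrite rmorphB /= bichartX bichartC chartX. Qed.

(* the coordinate on the second factor divides a power of the first one *)
Lemma diag_nilp N : exists M (v w : {poly {poly F}}),
  'X%:P ^+ M = 'X ^+ N * v + ('X - 'X%:P) ^+ k.+1 * w.
Proof.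
have [v0 [w0 E]] : exists (v w : {poly {poly F}}),
    'X%:P ^+ k.+1 = 'X * v + ('X - 'X%:P) ^+ k.+1 * w.
  have [v E] : exists v : {poly {poly F}},
      ('X - 'X%:P) ^+ k.+1 = 'X * v + (- 'X%:P) ^+ k.+1.
    elim: k => [|e [v E]]; first by exists 1; rewrite !expr1 mulr1.
    exists (('X - 'X%:P) ^+ e.+1 - 'X%:P * v).
    rewrite exprS [(- 'X%:P) ^+ e.+2]exprS mulrBl {2}E; ring.
  exists (- (-1) ^+ k.+1 * v), ((-1) ^+ k.+1).
  rewrite E [(- 'X%:P) ^+ _]exprNn; have := sqrr_sign {poly {poly F}} k.+1.
  set z := (-1) ^+ k.+1; set y := 'X%:P ^+ k.+1 => zz.
  transitivity (z ^+ 2 * y); first by rewrite zz mul1r.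
  ring.
elim: N => [|N [M [v [w IH]]]].
  by exists 0, 1, 0; rewrite !expr0 mulr0 addr0 mulr1.
exists (k.+1 + M), (v0 * v), (w0 * 'X%:P ^+ M + 'X * v0 * w).
rewrite exprD {1}E mulrDl {1}IH [in RHS]exprS; ring.
Qed.

Definition pp_glue (i : bool) : bilaurent F :=
  if i then right_coord F false ^+ n else 1.

Lemma pp_glueK i : exists c, pp_glue i * c = 1.
Proof.
case: i; last by exists 1; rewrite mulr1.
exists (right_coord F true ^+ n).
by rewrite -exprMn (right_coordK F false) expr1n.
Qed.

Definition pp_res i (x : pp_sec) : pp_sec01 :=
  pp_cl01 (bichart i (repr (x : {ideal_quot _})) * pp_glue i).

Lemma pp_resE i f : pp_res i (pp_cl f) = pp_cl01 (bichart i f * pp_glue i).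
Proof.
apply/pp_cl01_eq; rewrite -mulrBl -rmorphB mulrC; apply: ideal_powMl.
have /pp_cl_eq/diag_gen_pow[h ->] : pp_cl (repr (pp_cl f : {ideal_quot _}))
  = pp_cl f by exact: reprK.
by rewrite rmorphM rmorphXn /= bichart_diag; apply: ideal_pow_exp.
Qed.

Fact pp_res_is_linear i : linear_for (chart i \; *:%R) (pp_res i).
Proof.
move=> a x y; have [f ->] := pp_cl_surj x; have [g ->] := pp_cl_surj y.
rewrite pp_clZ -raddfD !pp_resE.
rewrite rmorphD rmorphM mulrDl raddfD /= pp_cl01Z.
by rewrite bichartC mulrA.
Qed.

HB.instance Definition _ i := GRing.isLinear.Build {poly F} _ _ _
  (pp_res i) (@pp_res_is_linear i).

Fact pp_res_eq0 i x : pp_res i x = 0 -> exists N, 'X^N *: x = 0.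
Proof.
have [f ->] := pp_cl_surj x; rewrite pp_resE.
rewrite -(raddf0 pp_cl01) => /pp_cl01_eq; rewrite subr0 => fJ.
have [c cP] := pp_glueK i.
have /(diag_gen01_pow i)[g gP] : bichart i f \in ideal_pow diag_gen01 k.+1.
  by rewrite -[bichart i f]mulr1 -cP mulrA mulrC; apply: ideal_powMl.
have [N [h hP]] := bichart_denom i g.
have E : ('X%:P * 'X) ^+ N * f = h * ('X - 'X%:P) ^+ k.+1.
  apply: (@bichart_inj F i); rewrite !rmorphM !rmorphXn rmorphM /=.
  by rewrite bichart_diag bichartX bichartC chartX gP mulrA hP.
have [M [v [w vwP]]] := diag_nilp N.
exists (N + M); rewrite pp_clZ -(raddf0 pp_cl); apply/pp_cl_eq.
rewrite subr0 rmorphXn /= exprD vwP.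
have -> : 'X%:P ^+ N * ('X ^+ N * v + ('X - 'X%:P) ^+ k.+1 * w) * f
    = (v * h + 'X%:P ^+ N * w * f) * ('X - 'X%:P) ^+ k.+1.
  rewrite [RHS]mulrDl -[v * h * _]mulrA -E exprMn; ring.
exact: (ideal_pow_exp diag_gen k.+1 tt).
Qed.

Fact pp_res_frac i y :
  exists N x, left_coord F i ^+ N *: y = pp_res i x.
Proof.
have [b ->] := pp_cl01_surj y.
have [c cP] := pp_glueK i; have [N [h hP]] := bichart_denom i (b * c).
have [M [v [w vwP]]] := diag_nilp N.
exists (N + M), (pp_cl (v * h)); rewrite pp_resE pp_cl01Z.
apply/pp_cl01_eq; rewrite [bichart i (v * h)]rmorphM /= -hP.
have := congr1 (bichart i) vwP.
rewrite rmorphD !rmorphM !rmorphXn /= bichart_diag bichartX bichartC chartX.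
rewrite exprD => ->; set D := diag_gen01 i ^+ k.+1.
set z := incl _; set r := right_coord F i.
rewrite [X in X \in _](_ : _ = z ^+ N * bichart i w * b * D).
  exact: ideal_pow_exp.
transitivity (z ^+ N * (r ^+ N * bichart i v + D * bichart i w) * b
   - bichart i v * (z * r) ^+ N * b * (pp_glue i * c)); first by ring.
rewrite cP exprMn; ring.
Qed.

Definition pp : qcoh := @Qcoh (fun=> pp_sec) pp_sec01
  (fun i => pp_res i) pp_res_eq0 pp_res_frac.

End PrincipalParts.

(* x_i^m in O(m)(U_i) *)
Definition lb_basis m i : sec (lb m) i := (1 : {poly F}^o).

(* dt^l (x) x_0^n in P^k(O(n))(U_0) for i = false,
   ds^l (x) x_1^n in P^k(O(n))(U_1) for i = true *)
Definition pp_basis k n i l : sec (pp k n) i := pp_cl k (('X - 'X%:P) ^+ l).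

(* binomial coefficient, 0 if b < 0 *)
Definition zbin (a : nat) (b : int) : nat :=
  if b is Posz c then 'C(a, c) else 0.

Definition scoef (n l j : nat) : int :=
  (-1) ^+ j * (zbin (n - j) (l%:Z - j%:Z))%:Z.

Section System.
Variables (k n r : nat).

(* row i is the equation for l = k - i, the last one being l = k - r *)
Definition Amx : 'M[int]_r.+1 := \matrix_(i, j) scoef n (k - i) j.
Definition bvec : 'cV[int]_r.+1 := \col_i (i == ord_max)%:R.

Definition solution (x : 'cV[F]_r.+1) : Prop :=
  map_mx intr Amx *m x = map_mx intr bvec.

Definition ccoef (x : 'cV[F]_r.+1) (l : nat) : F :=
  \sum_(j < r.+1) (scoef n l j)%:~R * x j 0.

(* over U_1 the variable 'X is 1/t *)
Definition is_phi (x : 'cV[F]_r.+1) (phi : qmor (lb (n - k)) (pp k n)) : Prop :=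
  mor phi false (lb_basis (n - k) false) =
    \sum_(l < (k - r).+1)
      (ccoef x l *: 'X^(k - r - l)) *: pp_basis k n false l
  /\
  mor phi true (lb_basis (n - k) true) =
    \sum_(j < r.+1) (x j 0 *: 'X^(r - j)) *: pp_basis k n true j.

End System.

Definition is_phi0 k n (phi : qmor (lb (n - k)) (pp k n)) : Prop :=
  mor phi false (lb_basis (n - k) false) =
    \sum_(l < k.+1) ('C(n, l)%:R *: 'X^(k - l)) *: pp_basis k n false l
  /\
  mor phi true (lb_basis (n - k) true) = pp_basis k n true 0.

End Modules.

(* Main.v *)
From HB Require Import structures.
Require Import Defs.
From mathcomp Require Import all_boot all_order all_algebra.
From mathcomp Require Import boolp ring zify generic_quotient perm.
Import GRing.Theory.
Local Open Scope ring_scope.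

Set Implicit Arguments.
Unset Strict Implicit.
Unset Printing Implicit Defensive.

(** Write t for x_1/x_0 on the first factor and u for it on the second one.
    On U_01 one has t (1/u - 1/t) = - (u - t) / u, and x_1^n = u^n x_0^n there, so
    expanding u^(n-j) = (t + (u - t))^(n-j) by the binomial theorem gives
      t^j ds^j (x) x_1^n
        = \sum_l (-1)^j 'C(n-j, l-j) t^(n-l) dt^l (x) x_0^n
    modulo (u - t)^(k+1) ([pp_transition]).  A map from O(n-k) is the same as a
    section over each chart, the two being related over U_01 by t^(n-k)
    ([lb_mor_exists], [lb_mor_unique]).  By the transition formula,
    \sum_j x_j t^(j-r) ds^j (x) x_1^n is t^(n-k) times
    \sum_l c_l t^(k-r-l) dt^l (x) x_0^n, where l runs up to k; the second sum
    has polynomial coefficients as soon as c_l = 0 for k - r < l <= k, which is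
    what the homogeneous equations of the system say ([phi_exists_unique]).  The
    map phi_0 is the case r = 0.

    For the isomorphism it is enough that the sum of the phi_r is bijective over
    U_0 and over U_1 ([qiso_of_bij]).  The Taylor coefficients at u = t identify
    the sections of P^k(O(n)) over a chart with row vectors of length k + 1
    ([jet_row_bij]), so the sum of the phi_r becomes a square matrix of
    polynomials.  Over U_1 it is triangular with diagonal entries x_{r,r}, hence
    invertible.  Over U_0 it is triangular for the other diagonal, whose entries
    are the c^r_{k-r}.  For r >= 1 they are 1, by the last equation of the
    system; for r = 0 the entry is 'C(n, k), which could vanish in F.  It does
    not: otherwise no section in the image over U_0 would have a component on
    dt^k, whereas over U_1 the section ds^k (x) x_1^n is in the image, and over
    U_01 it is a unit times dt^k (x) x_0^n ([last_jet_not_identically0],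
    [ccoef0_neq0]). *)

(** * Isomorphisms are detected on the two charts *)

Section Isomorphism.
Variables (F : fieldType) (M N : qcoh F).

Lemma left_coordXK i m : left_coord F i ^+ m * left_coord F (~~ i) ^+ m = 1.
Proof. by rewrite -exprMn left_coordK expr1n. Qed.

Lemma left_coord_scale_inj i m (V : lmodType (laurent F)) :
  injective (fun y : V => left_coord F i ^+ m *: y).
Proof.
move=> x y /(congr1 (fun z => left_coord F (~~ i) ^+ m *: z)).
by rewrite !scalerA mulrC left_coordXK !scale1r.
Qed.

Lemma resXZ (P : qcoh F) i m (x : sec P i) :
  res P i ('X^m *: x) = left_coord F i ^+ m *: res P i x.
Proof. by rewrite linearZ_LR /= rmorphXn /= chartX. Qed.

(** The sections over U_01 are fractions of those over U_i, with a power of the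
    coordinate as denominator, so bijectivity passes to the localization. *)
Lemma mor01_bij (f : qmor M N) i : bijective (mor f i) -> bijective (mor01 f).
Proof.
case=> g gK fK.
have finj : injective (mor01 f).
  move=> y y' /eqP; rewrite -subr_eq0 -raddfB => /eqP E.
  apply/eqP; rewrite -subr_eq0; apply/eqP; move: (y - y') E => {y y'} y E.
  have [m [x Ex]] := res_frac i y.
  have := congr1 (fun z => left_coord F i ^+ m *: z) E; rewrite /= scaler0.
  rewrite -linearZ Ex mor_res => /res_eq0[m' E'].
  have x0 : 'X^m' *: x = 0.
    by apply: (can_inj gK); rewrite linearZ_LR /= E' linear0.
  apply: (@left_coord_scale_inj i (m' + m)).
  by rewrite exprD -scalerA Ex -resXZ x0 linear0 scaler0.
suff /choice[h hK] z : exists y, mor01 f y = z.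
  by exists h => // y; apply: finj; rewrite hK.
have [m [x Ex]] := res_frac i z.
exists (left_coord F (~~ i) ^+ m *: res M i (g x)).
rewrite linearZ_LR mor_res fK -Ex scalerA.
by rewrite mulrC left_coordXK scale1r.
Qed.

Lemma qiso_of_bij (f : qmor M N) :
  (forall i, bijective (mor f i)) -> is_qiso f.
Proof.
move=> fb.
have [g gP] : exists g : forall i, sec N i -> sec M i,
    forall i, cancel (mor f i) (g i) /\ cancel (g i) (mor f i).
  have [g0 ? ?] := fb false; have [g1 ? ?] := fb true.
  by exists (fun i => if i as i0 return sec N i0 -> sec M i0 then g1 else g0);
    case.
have [g01 g01K f01K] := mor01_bij (fb false).
have glin i : linear (g i).
  have [gK fK] := gP i => a x y.
  by apply: (can_inj gK); rewrite linearP !fK.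
have g01lin : linear g01.
  by move=> a x y; apply: (can_inj g01K); rewrite linearP !f01K.
pose gi i : {linear sec N i -> sec M i} :=
  HB.pack (g i) (GRing.isLinear.Build _ _ _ _ _ (glin i)).
pose gi01 : {linear sec01 N -> sec01 M} :=
  HB.pack g01 (GRing.isLinear.Build _ _ _ _ _ g01lin).
have gres i x : gi01 (res N i x) = res M i (gi i x).
  apply: (can_inj g01K); rewrite mor_res [LHS]f01K /=.
  by have [_ ->] := gP i.
exists (@Qmor F N M gi gi01 gres); split; split => /=.
- by move=> i x /=; have [-> _] := gP i.
- exact: g01K.
- by move=> i x /=; have [_ ->] := gP i.
- exact: f01K.
Qed.

End Isomorphism.

(** * Coordinates on the sections of the principal parts *)

Section Taylor.
Variables (R : comNzRingType) (c : R).

(** The coefficient of ('X - c)^l in the Taylor expansion of f at c. *)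
Definition taylor (f : {poly R}) (l : nat) : R := (f \Po ('X + c%:P))`_l.

Lemma taylorB f g l : taylor (f - g) l = taylor f l - taylor g l.
Proof. by rewrite /taylor raddfB coefB. Qed.

Lemma taylorD f g l : taylor (f + g) l = taylor f l + taylor g l.
Proof. by rewrite /taylor raddfD coefD. Qed.

Lemma taylorZ a f l : taylor (a%:P * f) l = a * taylor f l.
Proof. by rewrite /taylor mul_polyC linearZ_LR coefZ. Qed.

Lemma comp_poly_shiftXn j : ('X - c%:P) ^+ j \Po ('X + c%:P) = 'X^j.
Proof. by rewrite rmorphXn /= comp_polyB comp_polyX comp_polyC addrK. Qed.

Lemma taylor_shiftXn j l : taylor (('X - c%:P) ^+ j) l = (l == j)%:R.
Proof. by rewrite /taylor comp_poly_shiftXn coefXn. Qed.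

Lemma taylor_mul_shiftXn h e l : (l < e)%N ->
  taylor (h * ('X - c%:P) ^+ e) l = 0.
Proof.
by move=> le; rewrite /taylor rmorphM /= comp_poly_shiftXn coefMXn le.
Qed.

Lemma taylor_expansion f e : exists h,
  f = \sum_(l < e) (taylor f l)%:P * ('X - c%:P) ^+ l + h * ('X - c%:P) ^+ e.
Proof.
set g := f \Po ('X + c%:P); exists (drop_poly e g \Po ('X - c%:P)).
rewrite -[LHS](comp_polyXaddC_K _ c) -/g -[in LHS](poly_take_drop e g).
rewrite rmorphD rmorphM rmorphXn /= comp_polyX; congr (_ + _).
rewrite /take_poly poly_def raddf_sum; apply: eq_bigr => l _.
by rewrite /= linearZ_LR /= comp_Xn_poly -mul_polyC.
Qed.

End Taylor.

Section Coordinates.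
Variables (F : fieldType) (k n : nat) (i : bool).
Local Notation sec := (sec (pp F k n) i).
Local Notation e := (pp_basis F k n i).

(** In {poly {poly F}} the outer variable is the coordinate on the second factor
    and the inner one, at which the expansion is made, that on the first factor:
    the entries are the coordinates on the basis dt^l, respectively ds^l. *)
Definition jet_row (x : sec) : 'rV[{poly F}]_k.+1 :=
  \row_l taylor 'X (repr (x : {ideal_quot _})) l.

Lemma jet_rowE f : jet_row (pp_cl k f) = \row_l taylor 'X f l.
Proof.
apply/rowP => l; rewrite !mxE; apply/eqP; rewrite -subr_eq0 -taylorB.
have /pp_cl_eq/diag_gen_pow[h ->] : pp_cl k (repr (pp_cl k f : {ideal_quot _}))
  = pp_cl k f by exact: reprK.
by rewrite taylor_mul_shiftXn.
Qed.

Fact jet_row_is_linear : linear jet_row.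
Proof.
move=> a x y; have [f ->] := pp_cl_surj x; have [g ->] := pp_cl_surj y.
rewrite [a *: _]pp_clZ -[pp_cl k _ + _]raddfD !jet_rowE.
by apply/rowP => l; rewrite !mxE taylorD taylorZ.
Qed.

HB.instance Definition _ :=
  GRing.isLinear.Build {poly F} sec _ _ jet_row jet_row_is_linear.

Lemma jet_rowZ a x : jet_row (a *: x) = a *: jet_row x.
Proof. exact: linearZ_LR. Qed.

Lemma jet_row_basis j (l : 'I_k.+1) : jet_row (e j) 0 l = (l == j :> nat)%:R.
Proof. by rewrite jet_rowE mxE taylor_shiftXn. Qed.

Lemma pp_basis_expansion (x : sec) : x = \sum_(l < k.+1) jet_row x 0 l *: e l.
Proof.
have [f ->] := pp_cl_surj x; rewrite jet_rowE.
have [h fE] := taylor_expansion 'X f k.+1.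
transitivity (pp_cl k (\sum_(l < k.+1) (taylor 'X f l)%:P * ('X - 'X%:P) ^+ l)).
  apply/pp_cl_eq; rewrite {1}fE addrAC subrr add0r.
  exact: (ideal_pow_exp (diag_gen F) k.+1 tt).
rewrite raddf_sum; apply: eq_bigr => l _.
by rewrite mxE [RHS]pp_clZ.
Qed.

Lemma jet_row_bij : bijective jet_row.
Proof.
exists (fun v : 'rV_k.+1 => \sum_(l < k.+1) v 0 l *: e l) => [x|v].
  by rewrite -pp_basis_expansion.
rewrite raddf_sum; apply/rowP => l; rewrite summxE (bigD1 l) //=.
rewrite jet_rowZ mxE jet_row_basis eqxx mulr1 big1 ?addr0 // => j jl.
rewrite jet_rowZ mxE jet_row_basis.
by rewrite [_ == _](_ : _ = false) ?mulr0 //; apply/negbTE; rewrite eq_sym.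
Qed.

End Coordinates.

(** * The change of basis between the two charts *)

Section Transition.
Variables (F : fieldType) (k n : nat).
Local Notation t := (left_coord F false).
Local Notation tV := (left_coord F true).
Local Notation E l := (res (pp F k n) false (pp_basis F k n false l)).
Local Notation S j := (res (pp F k n) true (pp_basis F k n true j)).

Lemma scoefE l j : (j <= l)%N -> scoef n l j = (-1) ^+ j * 'C(n - j, l - j)%:Z.
Proof. by move=> jl; rewrite /scoef subzn. Qed.

Lemma scoef_eq0 l j : (l < j)%N -> scoef n l j = 0.
Proof.
move=> lj; rewrite /scoef (_ : zbin _ _ = 0%N) ?mulr0 //.
rewrite -opprB subzn; last exact: ltnW.
by case: (j - l)%N (subn_gt0 l j) => [|m _]; rewrite ?lj.
Qed.

(** With a = t, b = u and a', b' their inverses, this is the transition formula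
    before reduction modulo a power of (u - t). *)
Lemma inv_diff_expansion (R : comNzRingType) (a a' b b' : R) j :
  a * a' = 1 -> b * b' = 1 -> (j <= n)%N ->
  a ^+ j * ((b' - a') ^+ j * b ^+ n)
  = \sum_(0 <= l < n.+1) (scoef n l j)%:~R * (a ^+ (n - l) * (b - a) ^+ l).
Proof.
move=> aa bb jn.
have -> : a ^+ j * ((b' - a') ^+ j * b ^+ n) = (- (b - a)) ^+ j * b ^+ (n - j).
  rewrite -{1}(subnKC jn) exprD !mulrA -!exprMn; congr (_ ^+ _ * _).
  transitivity (a * (b * b') - b * (a * a')); first by ring.
  by rewrite aa bb; ring.
(* the terms with l < j vanish; the others are those of (a + (b - a))^(n-j) *)
rewrite (big_cat_nat (n := j)) ?leqW //= big_nat big1 ?add0r; last first.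
  by move=> l /andP[_ lj]; rewrite scoef_eq0 // mul0r.
rewrite -{3}[j]add0n big_addn subSn // big_mkord.
rewrite -{2}(subrK a b) [b - a + a]addrC exprDn mulr_sumr.
apply: eq_bigr => l _; rewrite scoefE ?leq_addl // addnK subnDA subnAC.
rewrite [in RHS]rmorphM rmorphXn rmorphN1 exprNn [_ ^+ (l + j)]exprD.
rewrite -mulr_natr; ring.
Qed.

Lemma incl_intXn (s : int) (a : laurent F) m :
  incl (s%:~R * a ^+ m) = s%:~R * incl a ^+ m.
Proof. by rewrite rmorphM rmorph_int rmorphXn. Qed.

Lemma pp_transition j : (k <= n)%N -> (j <= n)%N ->
  t ^+ j *: S j = \sum_(l < k.+1) ((scoef n l j)%:~R * t ^+ (n - l)) *: E l.
Proof.
move=> kn jn; rewrite [S j]pp_resE [LHS]pp_cl01Z.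
have EE l : E l = pp_cl01 k (diag_gen01 F false ^+ l).
  by rewrite [LHS]pp_resE mulr1 rmorphXn /= bichart_diag.
under eq_bigr do rewrite EE [_ *: _]pp_cl01Z.
rewrite -raddf_sum; apply/pp_cl01_eq.
rewrite [bichart _ _]rmorphXn /= bichart_diag [incl _]rmorphXn /=.
have aa : incl t * incl tV = 1 by rewrite -rmorphM left_coordK rmorph1.
rewrite (inv_diff_expansion aa (right_coordK F false) jn).
(* the terms with l > k are multiples of (u - t)^(k+1) *)
rewrite (big_cat_nat (n := k.+1)) //= big_mkord addrAC -sumrB big1 => [|l _].
  rewrite add0r big_nat rpred_sum // => l /andP[kl _].
  rewrite -/(diag_gen01 F false) -(subnK kl) [_ ^+ (_ + _)]exprD !mulrA.
  exact: ideal_pow_exp.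
by rewrite incl_intXn -mulrA subrr.
Qed.

End Transition.

(** * Construction of the maps phi_r *)

Section Maps.
Variables (F : fieldType) (m : nat) (N : qcoh F).

Lemma lb_mor_unique (f g : qmor (lb F m) N) :
  (forall i, mor f i (lb_basis F m i) = mor g i (lb_basis F m i)) ->
  qmor_eq f g.
Proof.
move=> fg; have E i : mor f i =1 mor g i.
  move=> x; have -> : x = x *: lb_basis F m i by rewrite -[LHS]mulr1.
  by rewrite !linearZ_LR fg.
split=> // y; have -> : y = y *: res (lb F m) false (lb_basis F m false).
  by rewrite [res _ _ _]mulr1 rmorph1 -[LHS]mulr1.
by rewrite [LHS]linearZ_LR [RHS]linearZ_LR !mor_res E.
Qed.

(** Over U_01 the basis elements of O(m) satisfy x_1^m = t^m x_0^m, so their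
    images only have to satisfy the same relation. *)
Lemma lb_mor_exists (v : forall i, sec N i) :
  res N true (v true) = left_coord F false ^+ m *: res N false (v false) ->
  exists f : qmor (lb F m) N, forall i, mor f i (lb_basis F m i) = v i.
Proof.
move=> vE.
pose scale i (a : sec (lb F m) i) : sec N i := (a : {poly F}) *: v i.
pose scale01 (a : sec01 (lb F m)) : sec01 N :=
  (a : laurent F) *: res N false (v false).
have scale_linear i : linear (scale i).
  by move=> a x y; rewrite /scale scalerDl scalerA.
have scale01_linear : linear scale01.
  by move=> a x y; rewrite /scale01 scalerDl scalerA.
pose f i : {linear sec (lb F m) i -> sec N i} :=
  HB.pack (scale i) (GRing.isLinear.Build _ _ _ _ _ (scale_linear i)).
pose f01 : {linear sec01 (lb F m) -> sec01 N} :=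
  HB.pack scale01 (GRing.isLinear.Build _ _ _ _ _ scale01_linear).
have f_res i x : f01 (res (lb F m) i x) = res N i (f i x).
  rewrite [RHS]linearZ_LR /= /scale01 -scalerA; congr (_ *: _).
  by case: i {x}; rewrite ?scale1r.
by exists (Qmor f_res) => i; rewrite /= /scale scale1r.
Qed.

End Maps.

Section Phi.
Variables (F : fieldType) (k n : nat).
Local Notation t := (left_coord F false).
Local Notation E l := (res (pp F k n) false (pp_basis F k n false l)).
Local Notation S j := (res (pp F k n) true (pp_basis F k n true j)).

Lemma cst_intM (s : int) (a : F) : cst (s%:~R * a) = s%:~R * cst a.
Proof. by rewrite rmorphM rmorph_int. Qed.

Lemma res_monomial_sum i m (a : 'I_m -> F) (d : 'I_m -> nat)
    (v : 'I_m -> sec (pp F k n) i) :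
  res (pp F k n) i (\sum_j (a j *: 'X^(d j)) *: v j)
  = \sum_j (cst (a j) * left_coord F i ^+ d j) *: res (pp F k n) i (v j).
Proof.
rewrite linear_sum; apply: eq_bigr => j _.
by rewrite linearZ_LR /= -mul_polyC rmorphM rmorphXn /= chartX chartC.
Qed.

(** After multiplication by t^r both candidates for the image of x_1^(n-k)
    become \sum_l c_l t^(n-l) dt^l (x) x_0^n.  The hypothesis is only about the
    homogeneous equations, so that the lemma applies to phi_0 as well. *)
Lemma phi_exists_unique r (x : 'cV[F]_r.+1) : (r <= k)%N -> (k <= n)%N ->
  (forall l, (k - r < l <= k)%N -> ccoef n x l = 0) ->
  exists phi : qmor (lb F (n - k)) (pp F k n),
    is_phi x phi /\ forall psi, is_phi x psi -> qmor_eq psi phi.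
Proof.
move=> rk kn c0.
pose v0 := \sum_(l < (k - r).+1)
  (ccoef n x l *: 'X^(k - r - l)) *: pp_basis F k n false l.
pose v1 := \sum_(j < r.+1) (x j 0 *: 'X^(r - j)) *: pp_basis F k n true j.
pose v i : sec (pp F k n) i :=
  if i as b return sec (pp F k n) b then v1 else v0.
have vE : res (pp F k n) true (v true)
    = t ^+ (n - k) *: res (pp F k n) false (v false).
  apply: (@left_coord_scale_inj F false r) => /=.
  rewrite /v1 /v0 !res_monomial_sum scalerA !scaler_sumr.
  transitivity (\sum_(l < k.+1) (cst (ccoef n x l) * t ^+ (n - l)) *: E l).
    transitivity (\sum_(j < r.+1) cst (x j 0) *: (t ^+ j *: S j)).
      apply: eq_bigr => j _; rewrite !scalerA; congr (_ *: _).
      have jr : (j <= r)%N by rewrite -ltnS.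
      rewrite mulrCA -[in t ^+ r](subnK jr) exprD [t ^+ (r - j) * _]mulrC.
      by rewrite -mulrA left_coordXK mulr1.
    under eq_bigr => j _.
      rewrite pp_transition //; last first.
        by apply: leq_trans kn; apply: leq_trans rk; rewrite -ltnS.
      rewrite scaler_sumr.
      over.
    rewrite exchange_big; apply: eq_bigr => l _ /=.
    under eq_bigr do rewrite scalerA mulrA.
    rewrite -scaler_suml; congr (_ *: _); rewrite -mulr_suml; congr (_ * _).
    rewrite /ccoef raddf_sum; apply: eq_bigr => j _.
    by rewrite /= cst_intM mulrC.
  rewrite -(big_mkord xpredT
    (fun l => (cst (ccoef n x l) * t ^+ (n - l)) *: E l)).
  rewrite (big_cat_nat (n := (k - r).+1)) //=; last by rewrite ltnS leq_subr.
  rewrite [X in _ + X]big_nat [X in _ + X]big1 => [|l /andP[? ?]]; last first.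
    by rewrite c0 ?rmorph0 ?mul0r ?scale0r // -ltnS; apply/andP.
  rewrite addr0 big_mkord; apply: eq_bigr => l _.
  rewrite !scalerA; congr (_ *: _).
  have lkr : (l <= k - r)%N by rewrite -ltnS.
  rewrite mulrCA -!exprD; congr (_ * _ ^+ _).
  lia.
have [phi phiE] := lb_mor_exists vE.
exists phi; split; first by split; exact: phiE.
move=> psi [psi0 psi1]; apply: lb_mor_unique => -[]; rewrite phiE.
  exact: psi1.
exact: psi0.
Qed.

End Phi.

(** * The equations of the system *)

Section SystemRows.
Variables (F : fieldType) (k n : nat).

Lemma solution_ccoef r (x : 'cV[F]_r.+1) : (r <= k)%N -> solution k n x ->
  (forall l, (k - r < l <= k)%N -> ccoef n x l = 0)
  /\ ccoef n x (k - r) = 1.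
Proof.
move=> rk xS.
have row_i (i : 'I_r.+1) : ccoef n x (k - i) = (i == ord_max)%:R.
  have /matrixP/(_ i 0) := xS; rewrite !mxE rmorph_nat => <-.
  by apply: eq_bigr => j _; rewrite !mxE.
split=> [l /andP[rl lk]|]; last by rewrite (row_i ord_max) eqxx.
have klr : (k - l < r)%N by lia.
have := row_i (Ordinal (ltnW klr : (k - l < r.+1)%N)).
rewrite /= subKn // => ->.
by rewrite -val_eqE /= ltn_eqF.
Qed.

Lemma is_phi0E (x : 'cV[F]_1) (phi : qmor (lb F (n - k)) (pp F k n)) :
  x 0 0 = 1 -> is_phi0 phi <-> is_phi x phi.
Proof.
move=> x1; rewrite /is_phi0 /is_phi subn0.
have cE l : ccoef n x l = 'C(n, l)%:R.
  by rewrite /ccoef big_ord1 x1 mulr1 scoefE // expr0 mul1r !subn0 -pmulrn.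
under eq_bigr do rewrite -cE.
by rewrite big_ord1 x1 subnn expr0 !scale1r.
Qed.

End SystemRows.

(** * The sum of the maps as a matrix over each chart *)

Section SumOfMaps.
Variables (F : fieldType) (k n m : nat).
Variables (phi : 'I_k.+1 -> qmor (lb F m) (pp F k n)) (i : bool).

Definition sum_mx : 'M[{poly F}]_k.+1 :=
  \matrix_r jet_row (mor (phi r) i (lb_basis F m i)).

Lemma sum_mxE r l : sum_mx r l = jet_row (mor (phi r) i (lb_basis F m i)) 0 l.
Proof. by rewrite mxE. Qed.

Lemma jet_row_qsum (g : sec (qpow (lb F m) k.+1) i) :
  jet_row (mor (qsum phi) i g)
  = (\row_r (g : {ffun 'I_k.+1 -> {poly F}}) r) *m sum_mx.
Proof.
rewrite mulmx_sum_row.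
transitivity (jet_row
  (\sum_r mor (phi r) i ((g : {ffun 'I_k.+1 -> {poly F}}) r))); first by [].
rewrite raddf_sum; apply: eq_bigr => r _.
rewrite rowK mxE -linearZ -linearZ; congr (jet_row (mor _ _ _)).
by rewrite -[LHS]mulr1.
Qed.

Lemma qsum_bij : sum_mx \in unitmx -> bijective (mor (qsum phi) i).
Proof.
move=> Bu; have [jinv jK _] := jet_row_bij F k n i.
exists (fun y : sec (pp F k n) i =>
  [ffun r => (jet_row y *m invmx sum_mx) 0 r]) => [g|y].
  by apply/ffunP => r; rewrite ffunE jet_row_qsum mulmxK // mxE.
apply: (can_inj jK); rewrite jet_row_qsum -[RHS](mulmxKV Bu).
by congr (_ *m _); apply/rowP => r; rewrite mxE ffunE.
Qed.

End SumOfMaps.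

Section Jets.
Variables (F : fieldType) (k n : nat).

Lemma jet_row_sum i m (a : 'I_m -> {poly F}) (l : 'I_k.+1) :
  jet_row (\sum_j a j *: pp_basis F k n i j) 0 l
  = \sum_j a j * (l == j :> nat)%:R.
Proof.
rewrite raddf_sum summxE; apply: eq_bigr => j _.
by rewrite /= jet_rowZ mxE jet_row_basis.
Qed.

Lemma jet_row_sum_ge i m (a : 'I_m -> {poly F}) (l : 'I_k.+1) : (m <= l)%N ->
  jet_row (\sum_j a j *: pp_basis F k n i j) 0 l = 0.
Proof.
move=> ml; rewrite jet_row_sum big1 // => j _.
by rewrite gtn_eqF ?mulr0 //; apply: leq_trans ml.
Qed.

Lemma jet_row_sum_eq i m (a : 'I_m -> {poly F}) (l : 'I_k.+1) (j : 'I_m) :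
  l = j :> nat -> jet_row (\sum_j a j *: pp_basis F k n i j) 0 l = a j.
Proof.
move=> lj; rewrite jet_row_sum (bigD1 j) //= lj eqxx mulr1 big1 ?addr0 // => p.
by move=> /negPf pj; rewrite eq_sym val_eqE pj mulr0.
Qed.

(** Over U_01 the section ds^k (x) x_1^n equals (-1)^k t^(n-2k) dt^k (x) x_0^n,
    since ds^k is already divisible by (u - t)^k.  If it lifts along f over
    U_1, then, after clearing denominators, some power of t times dt^k is in the
    image of f over U_0. *)
Lemma last_jet_not_identically0 (M : qcoh F) (f : qmor M (pp F k n)) :
  (k <= n)%N ->
  bijective (mor f true) ->
  ~ (forall x, jet_row (mor f false x) 0 ord_max = 0).
Proof.
move=> kn [finv _ fK] f0.
set ek := pp_basis F k n false k.
have [N [g gE]] := res_frac false (res M true (finv (pp_basis F k n true k))).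
have E : res (pp F k n) false ('X^k *: mor f false g)
    = res (pp F k n) false (((-1) ^+ k * 'X^(N + (n - k))) *: ek).
  rewrite resXZ -mor_res -gE [mor01 f _]linearZ_LR mor_res fK.
  rewrite scalerA mulrC -[LHS]scalerA pp_transition // big_ord_recr big1 /=.
    rewrite add0r scoefE // subnn bin0 mulr1 scalerA rmorphXn rmorphN1.
    rewrite [RHS]linearZ_LR /= [chart _ _]rmorphM !rmorphXn rmorphN1 /= chartX.
    by rewrite mulrCA -exprD.
  by move=> l _; rewrite scoef_eq0 // mul0r scale0r.
have [M' M'E] : exists m, 'X^m *: ('X^k *: mor f false g
    - ((-1) ^+ k * 'X^(N + (n - k))) *: ek) = 0.
  by apply: (@res_eq0 F (pp F k n) false); rewrite linearB /= E subrr.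
have := congr1 (fun v => jet_row v 0 ord_max) M'E.
rewrite raddf0 jet_rowZ raddfB /= !jet_rowZ.
have ek1 : jet_row ek 0 ord_max = 1 by rewrite jet_row_basis eqxx.
move: (jet_row ek) ek1 (jet_row _) (f0 g) => v v1 w w0.
rewrite !mxE v1 w0 mulr0 sub0r mulr1 => /eqP.
by rewrite mulf_eq0 oppr_eq0 mulf_eq0 signr_eq0 !expf_eq0 polyX_eq0 !andbF.
Qed.

End Jets.

Lemma trig_unitmx (R : comUnitRingType) m (A : 'M[R]_m) :
  is_trig_mx A -> (forall i, A i i \is a GRing.unit) -> A \in unitmx.
Proof. by move=> At Au; rewrite unitmxE det_trig // rpred_prod. Qed.

(** * Invertibility of the matrices *)

Section Splitting.
Variables (F : fieldType) (k n : nat).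
Variables (x : forall r, 'cV[F]_r.+1).
Variables (phi : 'I_k.+1 -> qmor (lb F (n - k)) (pp F k n)).
Hypothesis kn : (k <= n)%N.
Hypothesis phiP : forall r : 'I_k.+1, is_phi (x r) (phi r).

Lemma sum_mx1_unit : (forall r : 'I_k.+1, x r ord_max 0 != 0) ->
  sum_mx phi true \in unitmx.
Proof.
move=> x0; apply: trig_unitmx => [|r].
  apply/is_trig_mxP => r l rl; rewrite sum_mxE; have [_ ->] := phiP r.
  by rewrite jet_row_sum_ge.
rewrite sum_mxE; have [_ ->] := phiP r.
rewrite (@jet_row_sum_eq _ _ _ _ _ _ _ ord_max) //= subnn expr0 alg_polyC.
by apply: rmorph_unit; rewrite unitfE.
Qed.

(** The row of phi_r stops at dt^(k-r): reversing the order of the rows makes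
    the matrix lower triangular. *)
Lemma sum_mx0_unit : (forall r : 'I_k.+1, ccoef n (x r) (k - r) != 0) ->
  sum_mx phi false \in unitmx.
Proof.
move=> c0; pose s := perm (@rev_ord_inj k.+1).
suff : row_perm s (sum_mx phi false) \in unitmx.
  by rewrite row_permE unitmx_mul unitmx_perm.
apply: trig_unitmx => [|r].
  apply/is_trig_mxP => r l rl; rewrite mxE sum_mxE; have [-> _] := phiP (s r).
  by rewrite jet_row_sum_ge // permE /= subSS subKn // -ltnS.
rewrite mxE sum_mxE; have [-> _] := phiP (s r).
have sE : r = (ord_max : 'I_(k - s r).+1) :> nat.
  by rewrite permE /= subSS subKn // -ltnS.
rewrite (jet_row_sum_eq _ _ _ sE) /= subnn expr0 alg_polyC.
by apply: rmorph_unit; rewrite unitfE.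
Qed.

(** This is 'C(n, k) x_{0,0}, which could vanish in positive characteristic.  It
    is the only possibly nonzero entry in the last column of the matrix over U_0:
    if it vanished, dt^k would not occur in any image over U_0. *)
Lemma ccoef0_neq0 : bijective (mor (qsum phi) true) ->
  ccoef n (x 0) (k - 0) != 0.
Proof.
move=> bij1; apply/eqP => c0; apply: (last_jet_not_identically0 kn bij1) => g.
rewrite jet_row_qsum mxE big1 // => r _; rewrite sum_mxE.
have [-> _] := phiP r; case: (posnP r) => r0; last first.
  by rewrite jet_row_sum_ge ?mulr0 //=; have := ltn_ord r; lia.
have maxE : (ord_max : 'I_k.+1) = (ord_max : 'I_(k - r).+1) :> nat.
  by rewrite /= r0 subn0.
by rewrite (jet_row_sum_eq _ _ _ maxE) /= r0 c0 scale0r mulr0.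
Qed.

Lemma qsum_phi_qiso :
  (forall r : 'I_k.+1, (0 < r)%N -> ccoef n (x r) (k - r) != 0) ->
  (forall r : 'I_k.+1, x r ord_max 0 != 0) -> is_qiso (qsum phi).
Proof.
move=> c0 x0; have bij1 := qsum_bij (sum_mx1_unit x0).
apply: qiso_of_bij => -[//|]; apply: qsum_bij; apply: sum_mx0_unit => r.
by case: (posnP r) => [->|/c0//]; apply: ccoef0_neq0.
Qed.

End Splitting.

Theorem theorem5p2 (F : fieldType) (k n : nat) (hk : (1 <= k)%N)
    (hkn : (k <= n)%N) :
  (forall (r : nat) (x : 'cV[F]_r.+1), (1 <= r <= k)%N -> solution k n x ->
     exists phi : qmor (lb F (n - k)) (pp F k n),
       is_phi x phi /\ forall psi, is_phi x psi -> qmor_eq psi phi)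
  /\
  (exists phi : qmor (lb F (n - k)) (pp F k n),
     is_phi0 phi /\ forall psi, is_phi0 psi -> qmor_eq psi phi)
  /\
  (forall x : forall r : nat, 'cV[F]_r.+1,
     x 0%N 0 0 = 1 ->
     (forall r : nat, (1 <= r <= k)%N -> solution k n (x r)) ->
     \prod_(i < k.+1) x i ord_max 0 != 0 ->
     forall phi : 'I_k.+1 -> qmor (lb F (n - k)) (pp F k n),
       is_phi0 (phi ord0) ->
       (forall i : 'I_k.+1, (1 <= i)%N -> is_phi (x i) (phi i)) ->
       is_qiso (qsum phi)).
Proof.
split=> [r x /andP[_ rk] xS|].
  by apply: phi_exists_unique => //; have [] := solution_ccoef rk xS.
split=> [|x x1 xS x_neq0 phi phi0 phiS].
  have x1 : (const_mx 1 : 'cV[F]_1) 0 0 = 1 by rewrite mxE.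
  (* phi_0 is phi_r for r = 0 and the vector (1) *)
  have [||phi [phiP phiU]] := @phi_exists_unique F k n 0 (const_mx 1) _ hkn.
  - by [].
  - move=> l; rewrite subn0 => /andP[kl lk].
    by have := leq_trans kl lk; rewrite ltnn.
  exists phi; split; first exact/(is_phi0E phi x1).
  by move=> psi /(is_phi0E psi x1); apply: phiU.
apply: (qsum_phi_qiso (x := x)) => //.
- move=> r; case: (posnP r) => [r0|/phiS//].
  have -> : r = ord0 by apply: val_inj.
  exact/(is_phi0E _ x1).
- move=> r r0; have rk : (r <= k)%N by rewrite -ltnS.
  have [|_ ->] := solution_ccoef rk (xS r _); last exact: oner_neq0.
  by rewrite r0.
- by move=> r; move/prodf_neq0: x_neq0; apply.
Qed.
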